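(* Let $\beta>0$ and $c>0$ be fixed. There exists a constant $\tilde\delta\in(0,1)$, independent of $n$, with the following two properties. (a) For $G$ drawn from $\mu_n$, with $\mu_n$-probability tending to $1$ as $n\to\infty$, $e_{U,U^c}(G)\ge(1-\tilde\delta)\,c\,|U|\log n$ for all $U\subseteq V$ with $|U|\le n/2$. (b) For any fixed $p$ with $0\le p<\exp\!\left(-\frac{1}{c(1-\tilde\delta)}\right)$, if $G$ is drawn from $\mu_n$ and then each edge of $G$ fails (is deleted) independently with probability $p$, the resulting graph on the vertex set $V$ is connected with probability tending to $1$ as $n\to\infty$.
   Context: For each sufficiently large $n$, let $E=E_n=\lfloor \tfrac12 c\,n\log n\rfloor$ (so that the mean degree $2E/n$ is $c\log n$ up to rounding). Let $\mu_n$ be the probability measure on simple labelled graphs $G$ with vertex set $V=\{1,\dots,n\}$ and exactly $E$ edges given by $\mu_n(G)=\frac1Z\exp\big(-\beta\sum_{i=1}^n d_i^2\big)$, where $d_i$ is the degree of vertex $i$ in $G$ and $Z$ is the normalizing constant. For $U\subseteq V$, $e_{U,U^c}(G)$ denotes the number of edges of $G$ with one endpoint in $U$ and the other in $U^c=V\setminus U$. *)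

(* Defs.v *)
From HB Require Import structures.
From mathcomp Require Import all_boot all_order all_algebra.
From mathcomp Require Import all_classical all_reals all_analysis.

Set Implicit Arguments.
Unset Strict Implicit.
Unset Printing Implicit Defensive.

Import Order.TTheory GRing.Theory Num.Theory.
Import numFieldNormedType.Exports.

Local Open Scope ring_scope.

(* A labelled graph on the vertex set 'I_n (vertices 0, ..., n - 1) is
   represented by its set of edges, an edge being a two-element vertex set. *)
Section Graphs.
Variable n : nat.
Implicit Types (G : {set {set 'I_n}}) (U : {set 'I_n}).

Definition simple_graph G : bool := [forall e in G, #|e| == 2%N].

Definition degree G (i : 'I_n) : nat := #|[set e in G | i \in e]|.

Definition cut_edges G U : nat :=
  #|[set e in G | [exists u in U, exists v in ~: U, e == [set u; v]]]|.

Definition connected_graph G : bool :=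
  [forall x, forall y, connect (fun u v : 'I_n => [set u; v] \in G) x y].

End Graphs.

Section Measures.
Variable R : realType.

(* [Num.truncn] is the floor on nonnegative reals. *)
Definition nb_edges (c : R) (n : nat) : nat :=
  Num.truncn (2^-1 * c * n%:R * ln n%:R).

Section FixedSize.
Variables (beta : R) (n m : nat).
Implicit Type G : {set {set 'I_n}}.

Definition weight G : R := expR (- beta * \sum_(i < n) (degree G i)%:R ^+ 2).

Definition partition_function : R :=
  \sum_(G : {set {set 'I_n}} | simple_graph G && (#|G| == m)) weight G.

(* When m exceeds the number of vertex pairs there is no such graph and mu
   vanishes identically. *)
Definition mu G : R :=
  if simple_graph G && (#|G| == m) then weight G / partition_function else 0.

Definition mu_prob (A : pred {set {set 'I_n}}) : R := \sum_(G | A G) mu G.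

End FixedSize.

(* Law of the set H of surviving edges when each edge of G is deleted
   independently with probability p. *)
Definition survival (p : R) (n : nat) (G H : {set {set 'I_n}}) : R :=
  if H \subset G then \prod_(e in G) (if e \in H then 1 - p else p) else 0.

Definition percolation_prob (beta : R) (n m : nat) (p : R)
    (A : pred {set {set 'I_n}}) : R :=
  \sum_(G : {set {set 'I_n}}) mu beta m G * \sum_(H | A H) survival p G H.

End Measures.

(* Main.v *)
(* Everything follows from switchings, i.e. from comparing the measures of two
   events through local moves between them. Moving one edge endpoint from or to
   a vertex v changes the weight by a factor governed by degree differences,
   because of the term beta * sum d_i^2; iterating, the degree of v deviates
   from the mean degree by a constant factor with superpolynomially small
   probability, so that all degrees are of order ln n. Given this, replacing
   edges xy inside U and zw outside U by xz and yw preserves all degrees, hence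
   the weight, and adds two edges to the cut of U. If the cut of U is at most a
   small multiple of s |U|, with s of order ln n, such moves outnumber the
   inverse ones by 4 n / |U|, so that a cut at most half of that multiple has
   probability at most (|U| / (4 n)) ^ (const * s * |U|), which beats the number
   of sets U. This gives (a) with 1 - delta = 1/256.
   For (b), a graph that gets disconnected loses all the edges in the cut of
   some U with 0 < |U| <= n/2. By (a), this has probability at most x ^ |U| for
   some x = n ^ - (1 + eta), and the sum of these bounds over U is at most
   (1 + x) ^ n - 1, which tends to 0. *)
Require Import Defs.
From HB Require Import structures.
From mathcomp Require Import all_boot all_order all_algebra.
From mathcomp Require Import all_classical all_reals all_analysis.
From mathcomp Require Import ring lra zify.

Set Implicit Arguments.
Unset Strict Implicit.
Unset Printing Implicit Defensive.

Import Order.TTheory GRing.Theory Num.Theory.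
Import numFieldNormedType.Exports.

Local Open Scope ring_scope.

(** * Edges, degrees and edge switches *)

Section SimpleGraphs.
Variable n : nat.
Implicit Types (G : {set {set 'I_n}}) (U e f : {set 'I_n}).

Definition adj G (x y : 'I_n) : bool := [set x; y] \in G.

Lemma adjC G x y : adj G x y = adj G y x.
Proof. by rewrite /adj finset.setUC. Qed.

Lemma eq_set2 (T : finType) (x y u v : T) :
  ([set x; y] == [set u; v]) = (x == u) && (y == v) || (x == v) && (y == u).
Proof.
apply/eqP/idP => [/setP exy|].
  move: (exy x) (exy y) (exy u) (exy v); rewrite !inE !eqxx ?orbT.
  rewrite (eq_sym u x) (eq_sym v x) (eq_sym u y) (eq_sym v y).
  by case: (x == u); case: (x == v); case: (y == u); case: (y == v).
by case/orP=> /andP[/eqP-> /eqP->] //; rewrite finset.setUC.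
Qed.

Lemma adj_neq G x y : simple_graph G -> adj G x y -> x != y.
Proof.
move=> /forall_inP sG /sG; rewrite cards2.
by case: (x != y).
Qed.

Lemma degreeE G x : simple_graph G -> degree G x = (\sum_y adj G x y)%N.
Proof.
move=> sG.
rewrite -big_mkcond /= sum1_card -(@card_in_imset _ _ (fun y => [set x; y])).
  apply: eq_card => e; rewrite inE; apply/andP/imsetP => [[eG xe]|[y]].
    have /cards2P [u [v [uv eE]]] := forall_inP sG _ eG.
    move: xe eG; rewrite {}eE !inE => /orP[]/eqP<- eG; first by exists v.
    by exists u; rewrite 1?finset.setUC //; rewrite unfold_in /adj finset.setUC.
  by rewrite unfold_in => xy ->; rewrite set21.
move=> y z; rewrite !unfold_in => xy xz /eqP; rewrite eq_set2 eqxx /=.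
by case/orP=> [/eqP//|/andP[/eqP-> /eqP->]].
Qed.

Lemma cut_edgesE G U :
  cut_edges G U = (\sum_(x in U) \sum_(y in ~: U) adj G x y)%N.
Proof.
rewrite pair_big /= -big_mkcondr /= sum1_card.
rewrite -(@card_in_imset _ _ (fun p => [set p.1; p.2])).
  apply: eq_card => e; rewrite inE; apply/andP/imsetP => [[eG]|[[x y]]].
    move=> /exists_inP[u uU /exists_inP[v vU /eqP eE]].
    by exists (u, v) => //=; rewrite unfold_in /= uU vU /adj -eE eG.
  rewrite unfold_in /= => /andP[/andP[xU yU] xy] ->; split => //.
  by apply/exists_inP; exists x => //; apply/exists_inP; exists y.
move=> [x y] [u v]; rewrite unfold_in /= => /andP[/andP[xU yU] _].
rewrite unfold_in /= inE => /andP[/andP[uU vU] _] /eqP; rewrite eq_set2.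
case/orP=> /andP[/eqP xE /eqP yE]; first by rewrite xE yE.
by rewrite xE (negPf vU) in xU.
Qed.

Lemma sum_degree G : simple_graph G -> (\sum_x degree G x = 2 * #|G|)%N.
Proof.
move=> sG; transitivity (\sum_x \sum_(e in G) (x \in e))%N.
  apply: eq_bigr => x _; rewrite -big_mkcondr /= sum1_card.
  by apply: eq_card => e; rewrite !inE.
rewrite exchange_big /= mulnC -sum_nat_const; apply: eq_bigr => e eG.
by rewrite -big_mkcond /= sum1_card; apply/eqP/(forall_inP sG).
Qed.

Definition swap f e G := e |: (G :\ f).

(** Stated with sums on both sides because the degree change may be negative and subtraction on
    [nat] truncates. *)
Lemma swap_degree G f e x : f \in G -> e \notin G ->
  (degree (swap f e G) x + (x \in f) = degree G x + (x \in e))%N.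
Proof.
have degE H : degree H x = (\sum_(d in H) (x \in d))%N.
  rewrite -big_mkcondr /= sum1_card.
  by apply: eq_card => d; rewrite !inE.
move=> fG eG; rewrite !degE big_setU1 ?inE ?(negPf eG) ?andbF //=.
by rewrite [in RHS](big_setD1 _ fG) /= [LHS]addnC -[RHS]addnA (addnC _ (x \in e : nat)).
Qed.

Lemma swap_card G f e : f \in G -> e \notin G -> #|swap f e G| = #|G|.
Proof.
move=> fG eG; rewrite cardsU1 !inE (negPf eG) andbF /=.
by rewrite [in RHS](cardsD1 f) fG.
Qed.

Lemma swap_simple G f e : simple_graph G -> #|e| = 2%N ->
  simple_graph (swap f e G).
Proof.
move=> /forall_inP sG e2; apply/forall_inP => d; rewrite !inE.
by case/orP=> [/eqP->|/andP[_ /sG//]]; rewrite e2.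
Qed.

Lemma swapK G f e : f \in G -> e \notin G -> swap e f (swap f e G) = G.
Proof.
move=> fG eG; apply/setP => d; rewrite !inE.
have [->|df] /= := eqVneq d f; first by rewrite fG.
by have [->|de] //= := eqVneq d e; rewrite (negPf eG).
Qed.

Lemma adj_swap G f e x y :
  adj (swap f e G) x y = ([set x; y] == e) || ([set x; y] != f) && adj G x y.
Proof. by rewrite /adj !inE. Qed.

End SimpleGraphs.

(** * Switching inequality for the Gibbs measure *)

Section Switching.
Variable R : realType.

(** Iterates the one-step switching bounds: [g i] will be the probability of an event relaxed [i]
    times, and [g m] is then bounded by 1. *)
Lemma geometric_chain (g : nat -> R) (q : R) m : 0 <= q ->
  (forall i, (i < m)%N -> g i <= q * g i.+1) -> g 0%N <= q ^+ m * g m.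
Proof.
move=> q0; elim: m => [|m IH] gq; first by rewrite expr0 mul1r.
apply: (le_trans (IH _)) => [i im|]; first by apply: gq; lia.
by rewrite exprSr -mulrA ler_wpM2l ?exprn_ge0 ?gq.
Qed.

Variables (beta : R) (n m : nat).
Implicit Types (G : {set {set 'I_n}}) (P Q : pred {set {set 'I_n}}).

Definition valid_graph G := simple_graph G && (#|G| == m).

Lemma mu_ge0 G : 0 <= mu beta m G.
Proof.
rewrite /mu; case: ifP => // _; rewrite divr_ge0 ?expR_ge0 // sumr_ge0 // => H _.
exact: expR_ge0.
Qed.

Lemma mu_invalid G : ~~ valid_graph G -> mu beta m G = 0.
Proof. by rewrite /mu /valid_graph => /negPf->. Qed.

Lemma mu_prob_ge0 P : 0 <= mu_prob beta m P.
Proof. by apply: sumr_ge0 => G _; exact: mu_ge0. Qed.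

Lemma mu_total : (m <= 'C(n, 2))%N -> \sum_(G : {set {set 'I_n}}) mu beta m G = 1.
Proof.
move=> mn; pose K := [set e : {set 'I_n} | #|e| == 2%N].
have [G0 vG0] : exists G0, valid_graph G0.
  have : (0 < #|[set G : {set {set 'I_n}} | G \subset K & #|G| == m]|)%N.
    by rewrite cards_draws card_draws card_ord bin_gt0.
  case/card_gt0P => G; rewrite !inE => /andP[/fintype.subsetP GK mG].
  exists G; rewrite /valid_graph mG andbT; apply/forall_inP => e /GK.
  by rewrite inE.
rewrite (eq_bigr (fun G => (if valid_graph G then weight beta G else 0) *
   (partition_function beta n m)^-1)); last first.
  by move=> G _; rewrite /mu /valid_graph; case: ifP; rewrite ?mul0r.
rewrite -mulr_suml -big_mkcond divff // gt_eqF // /partition_function.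
rewrite (bigD1 G0) //= ltr_pwDl ?expR_gt0 // sumr_ge0 // => G _.
exact: expR_ge0.
Qed.

Lemma mu_prob_sub P Q : (forall G, valid_graph G -> P G -> Q G) ->
  mu_prob beta m P <= mu_prob beta m Q.
Proof.
move=> PQ; rewrite /mu_prob big_mkcond [leRHS]big_mkcond ler_sum // => G _.
case PG: (P G); last by case: (Q G) => //; exact: mu_ge0.
have [vG|/mu_invalid->] := boolP (valid_graph G); last by case: (Q G).
by rewrite PQ.
Qed.

Lemma mu_prob_le1 P : (m <= 'C(n, 2))%N -> mu_prob beta m P <= 1.
Proof. by move=> /mu_total <-; exact: mu_prob_sub. Qed.

Lemma mu_probU P Q :
  mu_prob beta m (fun G => P G || Q G) <= mu_prob beta m P + mu_prob beta m Q.
Proof.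
rewrite /mu_prob big_mkcond [in leRHS]big_mkcond [X in _ + X]big_mkcond.
rewrite -big_split /=; apply: ler_sum => G _; have := mu_ge0 G.
by case: (P G); case: (Q G) => /=; lra.
Qed.

Lemma mu_prob_exists (I : finType) (D : pred I)
    (A : I -> pred {set {set 'I_n}}) :
  mu_prob beta m (fun G => [exists (i | D i), A i G]) <=
  \sum_(i | D i) mu_prob beta m (A i).
Proof.
rewrite /mu_prob (exchange_big_dep predT) //= big_mkcond /=.
apply: ler_sum => G _; case: ifP => [/existsP[i DA]|_].
  rewrite (bigD1 i) //= lerDl; apply: sumr_ge0 => j _; exact: mu_ge0.
by apply: sumr_ge0 => j _; exact: mu_ge0.
Qed.

(* Double counting of the moves G -> sigma i G: a graph in P has at least L
   of them (weighted by the ratio rho of the weights), and a graph in Q is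
   reached by at most M of them. *)
Lemma mu_switching (I : finType) P Q (A B : {set {set 'I_n}} -> pred I)
    (sigma tau : I -> {set {set 'I_n}} -> {set {set 'I_n}})
    (rho : {set {set 'I_n}} -> I -> R) (L : R) (M : nat) :
  (forall G i, valid_graph G -> P G -> A G i ->
     [/\ tau i (sigma i G) = G, Q (sigma i G), B (sigma i G) i &
         rho G i * mu beta m G <= mu beta m (sigma i G)]) ->
  (forall G, valid_graph G -> P G -> L <= \sum_(i | A G i) rho G i) ->
  (forall G, valid_graph G -> Q G -> (\sum_i B G i <= M)%N) ->
  L * mu_prob beta m P <= M%:R * mu_prob beta m Q.
Proof.
move=> move_ok fwd bwd.
pose D i := [set G | [&& valid_graph G, P G & A G i]].
have -> : mu_prob beta m P = \sum_(G | valid_graph G && P G) mu beta m G.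
  rewrite /mu_prob [RHS]big_mkcondl; apply: eq_bigr => G _.
  by case: ifP => // /negbT/mu_invalid.
(* Both bounds pass through the total mass of the images of all moves. As [tau i] undoes [sigma i],
   a graph is the image of at most one graph for each [i]. *)
apply: (@le_trans _ _ (\sum_i \sum_(G in D i) mu beta m (sigma i G))).
  rewrite mulr_sumr.
  rewrite (exchange_big_dep (fun G => valid_graph G && P G)) /=; last first.
    by move=> i G _; rewrite inE => /and3P[-> ->].
  apply: ler_sum => G /andP[vG PG].
  apply: (@le_trans _ _ (\sum_(i | A G i) rho G i * mu beta m G)).
    by rewrite -mulr_suml ler_wpM2r ?mu_ge0 ?fwd.
  rewrite [leRHS](eq_bigl (A G)); last by move=> i; rewrite inE vG PG.
  by apply: ler_sum => i AG; case: (move_ok G i).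
have inj i : {in D i &, injective (sigma i)}.
  move=> G H; rewrite !inE => /and3P[vG PG AG] /and3P[vH PH AH] GH.
  have [<- _ _ _] := move_ok _ _ vG PG AG.
  by have [<- _ _ _] := move_ok _ _ vH PH AH; rewrite GH.
apply: (@le_trans _ _ (\sum_i \sum_(G | Q G && B G i) mu beta m G)).
  apply: ler_sum => i _; rewrite -(big_imset (mu beta m) (inj i)) /=.
  rewrite big_mkcond [leRHS]big_mkcond; apply: ler_sum => G _.
  case: ifP => [/imsetP[H]|_]; last by case: ifP => // _; exact: mu_ge0.
  rewrite inE => /and3P[vH PH AH] ->.
  by have [_ -> -> _] := move_ok _ _ vH PH AH.
rewrite (exchange_big_dep Q) /=; last by move=> i G _ /andP[].
rewrite mulr_sumr; apply: ler_sum => G QG.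
have [vG|/mu_invalid->] := boolP (valid_graph G); last by rewrite big1 ?mulr0.
rewrite QG /= sumr_const -[leLHS]mulr_natl ler_wpM2r ?mu_ge0 // ler_nat.
by rewrite (leq_trans _ (bwd G vG QG)) // -big_mkcond /= sum1_card.
Qed.

Lemma valid_swap G f e : valid_graph G -> f \in G -> e \notin G -> #|e| = 2%N ->
  valid_graph (swap f e G).
Proof.
by move=> /andP[sG mG] fG eG e2; rewrite /valid_graph swap_simple ?swap_card.
Qed.

(** The degree of [x] is unchanged, the square at [v] grows by [2 d_v + 1] and that at [y] drops by
    [2 d_y - 1]. *)
Lemma mu_swap G (x y v : 'I_n) : valid_graph G ->
    adj G x y -> ~~ adj G x v -> x != v -> y != v ->
  mu beta m (swap [set x; y] [set x; v] G) =
  expR (2 * beta * ((degree G y)%:R - (degree G v)%:R - 1)) * mu beta m G.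
Proof.
move=> vG xy xv nxv nyv.
have nxy : x != y by case/andP: vG => sG _; exact: adj_neq sG xy.
have vG' : valid_graph (swap [set x; y] [set x; v] G).
  by rewrite valid_swap // cards2 nxv.
rewrite /mu -![simple_graph _ && _]/(valid_graph _) vG vG' mulrA.
congr (_ / _); rewrite -expRD; congr expR.
set G' := swap _ _ G.
have sqE i : (degree G' i)%:R ^+ 2 = (degree G i)%:R ^+ 2
    + (if i == v then 2 * (degree G v)%:R + 1 else 0)
    + (if i == y then 1 - 2 * (degree G y)%:R else 0) :> R.
  have := swap_degree i xy xv; rewrite -/G' !inE.
  have [->|nix] := eqVneq i x.
    by rewrite (negPf nxv) (negPf nxy) !addr0 /= => /addIn ->.
  have [->|niv] := eqVneq i v.
    rewrite eq_sym (negPf nyv) /= addn0 => ->.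
    by rewrite natrD /=; lra.
  have [->|niy] := eqVneq i y => /=; last by rewrite !addn0 !addr0 => ->.
  by rewrite addn0 => <-; rewrite natrD /=; lra.
rewrite (eq_bigr _ (fun i _ => sqE i)) !big_split /= -!big_mkcond /=.
by rewrite !big_pred1_eq; lra.
Qed.

Lemma mu_eq_degree G H : valid_graph G -> valid_graph H ->
  (forall x, degree H x = degree G x) -> mu beta m H = mu beta m G.
Proof.
move=> vG vH d; rewrite /mu -![simple_graph _ && _]/(valid_graph _) vG vH.
by congr (expR (_ * _) / _); apply: eq_bigr => x _; rewrite d.
Qed.

End Switching.

(** * Tails of the degrees *)

Section DegreeTails.
Variables (R : realType) (beta : R) (n m s : nat).
Hypotheses (beta_gt0 : 0 < beta) (s_gt0 : (0 < s)%N).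
Implicit Types (G : {set {set 'I_n}}).

(* Switching xy into xv multiplies mu by exp(2 beta (d_y - d_v - 1)), and since
   the mean degree is at least 8s, which exceeds d_v by a margin of order s, the
   gain is exp(4 beta s). *)
Lemma low_degree_step (v : 'I_n) (a : nat) :
  (4 * n * s <= m)%N -> (a < 4 * s)%N ->
  mu_prob beta m (fun G => (degree G v <= a)%N) <=
  2 * expR (- (4 * beta * s%:R)) *
    mu_prob beta m (fun G => (degree G v <= a.+1)%N).
Proof.
move=> le_m lt_a; set E := expR (4 * beta * s%:R).
have E_gt0 : 0 < E by exact: expR_gt0.
have n_gt0 : (0 < n)%N by rewrite (leq_ltn_trans _ (ltn_ord v)).
pose A G (p : 'I_n * 'I_n) :=
  [&& adj G p.2 p.1, ~~ adj G p.2 v, p.2 != v & p.1 != v].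
(* The image shows [x] as a neighbour of [v] but does not reveal [y], so [p.1] stays free: at most
   [n * a.+1] inverse moves. *)
pose B G (p : 'I_n * 'I_n) := (p.1 == p.1) && adj G v p.2.
pose rho G (p : 'I_n * 'I_n) :=
  expR (2 * beta * ((degree G p.1)%:R - a.+1%:R)).
have : 2 * s%:R * n%:R * E * mu_prob beta m (fun G => (degree G v <= a)%N) <=
    (n * a.+1)%:R * mu_prob beta m (fun G => (degree G v <= a.+1)%N).
  apply: (@mu_switching _ _ _ _ _ _ _ A B
    (fun p => swap [set p.2; p.1] [set p.2; v])
    (fun p => swap [set p.2; v] [set p.2; p.1]) rho) => G.
  - move=> [y x] vG dv /and4P[/= xy xv nxv nyv]; split.
    + exact: swapK.
    + have := swap_degree v xy xv; rewrite !inE eqxx orbT !(eq_sym v).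
      by rewrite (negPf nxv) (negPf nyv) /= addn0 addn1 => ->.
    + by rewrite /B /= eqxx /= adjC adj_swap eqxx.
    + rewrite mu_swap // ler_wpM2r ?mu_ge0 // /rho /= ler_expR.
      rewrite ler_wpM2l ?mulr_ge0 ?(ltW beta_gt0) // -natr1.
      by move: dv; rewrite -(ler_nat R); lra.
  - move=> vG dv; have /andP[sG /eqP mG] := vG.
    have -> : \sum_(p | A G p) rho G p = \sum_y \sum_(x | A G (y, x)) rho G (y, x).
      by rewrite pair_big_dep /=; apply: eq_big => [[]|[]].
    (* If [d_y >= a + 1 + 2 s], the ratio is at least [E] and at least [d_y - (a + 1)] neighbours
       [x] are allowed; otherwise the left side is negative. Summed over [y], this gives
       [2 m - n (a + 1) - 2 s n >= 2 s n] times [E]. *)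
    have inner y : ((degree G y)%:R - a.+1%:R - 2 * s%:R) * E <=
        \sum_(x | A G (y, x)) rho G (y, x).
      have [dy|dy] := leqP (a.+1 + 2 * s) (degree G y); last first.
        apply: (@le_trans _ _ 0); last by apply: sumr_ge0 => x _; exact: expR_ge0.
        rewrite pmulr_lle0 //.
        by move: dy; rewrite -(ltr_nat R) natrD natrM; lra.
      have nyv : y != v by apply/eqP => yv; move: dv dy; rewrite yv; lia.
      have cnt : (degree G y <= \sum_x A G (y, x) + a.+1)%N.
        have : (degree G y <= \sum_x (A G (y, x) + adj G v x + (x == v)))%N.
          rewrite degreeE //; apply: leq_sum => x _.
          rewrite /A /= nyv andbT (adjC G y) (adjC G v).
          by case: (adj G x y); case: (adj G x v); case: (x == v).
        rewrite !big_split /= -degreeE // -[X in (_ + X)%N]big_mkcond /=.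
        by rewrite big_pred1_eq; lia.
      move: cnt; set c := (\sum_x _)%N => cnt.
      have -> : \sum_(x | A G (y, x)) rho G (y, x) = c%:R * rho G (y, y).
        rewrite natr_sum mulr_suml big_mkcond; apply: eq_bigr => x _.
        by case: (A G (y, x)); rewrite ?mul1r ?mul0r.
      apply: ler_pM; rewrite ?(ltW E_gt0) //.
      + by move: dy; rewrite -(ler_nat R) natrD natrM; lra.
      + by move: cnt; rewrite -(ler_nat R) natrD; have := ler0n R s; lra.
      + rewrite ler_expR.
        have : 2 * s%:R <= (degree G y)%:R - a.+1%:R :> R.
          by move: dy; rewrite -(ler_nat R) natrD natrM; lra.
        by move=> /(ler_wpM2l (ltW beta_gt0)); lra.
    apply: (le_trans _ (ler_sum _ (fun y _ => inner y))).
    rewrite -mulr_suml ler_wpM2r ?(ltW E_gt0) // !sumrB !sumr_const.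
    rewrite -natr_sum sum_degree // mG card_ord.
    rewrite -(mulr_natr a.+1%:R) -(mulr_natr (2 * s%:R)).
    have : 8 * n%:R * s%:R <= (2 * m)%:R :> R.
      by rewrite -!natrM ler_nat; lia.
    have : n%:R * a.+1%:R <= n%:R * (4 * s%:R) :> R.
      by rewrite -!natrM ler_nat leq_mul2l lt_a orbT.
    by lra.
  - move=> vG dv; have /andP[sG _] := vG.
    rewrite -(pair_big predT predT (fun y x => B G (y, x) : nat)) /=.
    rewrite /B /=; under eq_bigr => y _ do rewrite eqxx /= -degreeE //.
    by rewrite sum_nat_const card_ord leq_mul2l dv orbT.
set p := mu_prob _ _ _; set p' := mu_prob _ _ _.
move=> H; have p0 : 0 <= p' by exact: mu_prob_ge0.
have : 2 * s%:R * n%:R * E * p <= 2 * s%:R * n%:R * E * (2 * E^-1 * p').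
  apply: (le_trans H).
  have -> : 2 * s%:R * n%:R * E * (2 * E^-1 * p') = (4 * s%:R * n%:R) * p'.
    by field; rewrite gt_eqF.
  by rewrite ler_wpM2r // -!natrM ler_nat mulnC leq_mul2r lt_a orbT.
by rewrite ler_pM2l ?expRN // !mulr_gt0 ?ltr0n.
Qed.

(* Here xv is switched into xy, with y among the vertices of degree at most
   32s: these are at least n/2 since the mean degree is at most 16s. *)
Lemma high_degree_step (v : 'I_n) (a : nat) :
  (4 <= n)%N -> (m <= 8 * n * s)%N -> (128 * s <= a)%N ->
  mu_prob beta m (fun G => (a < degree G v)%N) <=
  2 * expR (- (4 * beta * s%:R)) *
    mu_prob beta m (fun G => (a <= degree G v)%N).
Proof.
move=> n4 le_m le_a; set E := expR (4 * beta * s%:R).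
have E_gt0 : 0 < E by exact: expR_gt0.
pose A G (p : 'I_n * 'I_n) :=
  [&& adj G v p.1, ~~ adj G p.1 p.2, p.1 != p.2 & degree G p.2 <= 32 * s]%N.
pose B G (p : 'I_n * 'I_n) := adj G p.1 p.2.
have : (16 * s * n)%:R * E * mu_prob beta m (fun G => (a < degree G v)%N) <=
    (16 * s * n)%:R * mu_prob beta m (fun G => (a <= degree G v)%N).
  apply: (@mu_switching _ _ _ _ _ _ _ A B
    (fun p => swap [set p.1; v] [set p.1; p.2])
    (fun p => swap [set p.1; p.2] [set p.1; v]) (fun _ _ => E)) => G.
  - move=> [x y] vG dv /and4P[/=]; rewrite adjC => xv xy nxy dy.
    have nvy : v != y by apply/eqP => vy; move: dv dy; rewrite vy; lia.
    split.
    + exact: swapK.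
    + have := swap_degree v xv xy; rewrite !inE eqxx orbT (negPf nvy) orbF.
      by case: (v == x) => /=; lia.
    + by rewrite /B /= adj_swap eqxx.
    + rewrite mu_swap // ler_wpM2r ?mu_ge0 // /E ler_expR.
      have : 2 * s%:R <= (degree G v)%:R - (degree G y)%:R - 1 :> R.
        have : (2 * s + degree G y + 1 <= degree G v)%N by lia.
        by rewrite -(ler_nat R) 2!natrD natrM; lra.
      by move=> /(ler_wpM2l (ltW beta_gt0)); lra.
  - move=> vG dv; have /andP[sG /eqP mG] := vG.
    rewrite sumr_const -[leRHS]mulr_natl ler_wpM2r ?(ltW E_gt0) // ler_nat.
    set c := #|_|; have cE : c = (\sum_x \sum_y A G (x, y))%N.
      rewrite pair_big /= /c -sum1_card big_mkcond /=.
      by apply: eq_bigr => -[x y] _; rewrite unfold_in /A /=; case: ifP.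
    pose h := (\sum_(y : 'I_n) (degree G y <= 32 * s)%N)%N.
    have h_ge : (n <= 2 * h)%N.
      have : (\sum_(y : 'I_n) 32 * s <=
          \sum_y (degree G y + 32 * s * (degree G y <= 32 * s)))%N.
        by apply: leq_sum => y _; case: leqP; lia.
      rewrite [leqRHS]big_split /= sum_degree // mG sum_nat_const card_ord.
      have -> : (\sum_(y < n) 32 * s * (degree G y <= 32 * s) = 32 * s * h)%N.
        by rewrite /h big_distrr.
      move: (h) => k le_k; rewrite -(leq_pmul2l s_gt0).
      by move: le_k; clear -le_m; lia.
    (* A neighbour [x] of [v] excludes at most [d_x + 1] choices of [y]. As [h - 1 >= n / 4] for
       [n >= 4], at least [d_v (h - 1) - 2 m >= 32 s n - 16 s n] moves remain. *)
    have : (\sum_x (adj G v x) * h <=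
        \sum_x (\sum_y A G (x, y) + degree G x + adj G v x))%N.
      apply: leq_sum => x _.
      have one : (\sum_(y : 'I_n) (y == x) = 1)%N.
        by rewrite -big_mkcond /= big_pred1_eq.
      case vx: (adj G v x); last by rewrite mul0n.
      rewrite mul1n [nat_of_bool true]/= -[1%N in leqRHS]one /h degreeE // -!big_split /=.
      apply: leq_sum => y _; rewrite /A /= vx /= eq_sym.
      by case: (adj G x y); case: (y == x); case: (degree G y <= _)%N.
    rewrite !big_split /= -cE sum_degree // mG -big_distrl /= -degreeE //.
    nia.
  - move=> vG _; have /andP[sG /eqP mG] := vG.
    rewrite -(pair_big predT predT (fun y x => B G (y, x) : nat)) /=.
    rewrite /B /=; under eq_bigr => y _ do rewrite -degreeE //.
    by rewrite sum_degree // mG; lia.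
set p := mu_prob _ _ _; set p' := mu_prob _ _ _.
have p0 : 0 <= p' by exact: mu_prob_ge0.
rewrite -mulrA ler_pM2l ?ltr0n ?muln_gt0; last lia.
(* The counts give the factor [E^-1]; the additional 2 only matches the bound of
   [low_degree_step]. *)
move=> H; rewrite expRN -(ler_pM2l E_gt0) (le_trans H) //.
have -> : E * (2 * E^-1 * p') = 2 * p' by field; rewrite gt_eqF.
by lra.
Qed.

(** Both thresholds leave room for [3 s] steps: from [s] up to [4 s] with [low_degree_step], and
    from [131 s] down to [128 s] with [high_degree_step]. *)
Definition good_degrees G := [forall v, (s < degree G v <= 131 * s)%N].

Lemma good_degrees_prob : (4 <= n)%N -> (4 * n * s <= m <= 8 * n * s)%N ->
    (m <= 'C(n, 2))%N ->
  mu_prob beta m (fun G => ~~ good_degrees G) <=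
  2 * n%:R * (2 * expR (- (4 * beta * s%:R))) ^+ (3 * s).
Proof.
move=> n4 /andP[m4 m8] mC; set q := 2 * expR _.
have q0 : 0 <= q by rewrite mulr_ge0 ?expR_ge0.
have low v : mu_prob beta m (fun G => (degree G v <= s)%N) <= q ^+ (3 * s).
  pose g i := mu_prob beta m (fun G => (degree G v <= s + i)%N).
  have := @geometric_chain R g q (3 * s) q0 _; rewrite /g addn0 => H.
  apply: (le_trans (H _)) => [i ilt|].
    by rewrite addnS; apply: low_degree_step => //; lia.
  by rewrite -[leRHS]mulr1 ler_wpM2l ?exprn_ge0 ?mu_prob_le1.
have high v : mu_prob beta m (fun G => (131 * s < degree G v)%N) <= q ^+ (3 * s).
  pose g i := mu_prob beta m (fun G => ((131 * s).+1 - i <= degree G v)%N).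
  have := @geometric_chain R g q (3 * s) q0 _; rewrite /g subn0 => H.
  apply: (le_trans (H _)) => [i ilt|].
    by rewrite subSS subSn; [apply: high_degree_step => //; lia|lia].
  by rewrite -[leRHS]mulr1 ler_wpM2l ?exprn_ge0 ?mu_prob_le1.
apply: (@le_trans _ _ (mu_prob beta m
    (fun G => [exists (v | true), (degree G v <= s)%N] ||
              [exists (v | true), (131 * s < degree G v)%N]))).
  apply: mu_prob_sub => G _ /forallPn[v]; rewrite negb_and -leqNgt -ltnNge.
  by case/orP=> dv; apply/orP; [left|right]; apply/existsP; exists v.
apply: (le_trans (mu_probU _ _ _ _)).
have sum_const : \sum_(v : 'I_n) q ^+ (3 * s) = n%:R * q ^+ (3 * s).
  by rewrite sumr_const card_ord -[LHS]mulr_natl.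
apply: (@le_trans _ _ (n%:R * q ^+ (3 * s) + n%:R * q ^+ (3 * s))); last by lra.
by rewrite -sum_const lerD // (le_trans (mu_prob_exists _ _ _ _)) // ler_sum.
Qed.

End DegreeTails.

(** * Degree-preserving double switches *)

Section DoubleSwitch.
Variables (R : realType) (beta : R) (n m s : nat).
(* 524^2 = 16 * 131^2: with degrees at most 131 s, the neighbours of neighbours
   of a vertex are few compared with s * n. *)
Hypotheses (s_gt0 : (0 < s)%N) (n_large : (524 * 524 * s <= n)%N).
Implicit Types (G : {set {set 'I_n}}) (U A B : {set 'I_n}).

(** Ordered pairs are counted, so an edge inside [U] counts twice in [nb_adj G U U], while
    [nb_adj G U (~: U)] is the cut. *)
Definition nb_adj G A B : nat := (\sum_(x in A) \sum_(y in B) adj G x y)%N.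

Lemma nb_adjC G A B : nb_adj G A B = nb_adj G B A.
Proof.
rewrite /nb_adj exchange_big; apply: eq_bigr => y _; apply: eq_bigr => x _.
by rewrite adjC.
Qed.

Lemma nb_adjE G A B : nb_adj G A B =
  (\sum_x \sum_y [&& x \in A, y \in B & adj G x y])%N.
Proof.
rewrite /nb_adj big_mkcond; apply: eq_bigr => x _.
case: (x \in A); last by rewrite big1.
by rewrite big_mkcond; apply: eq_bigr => y _; case: (y \in B).
Qed.

Lemma sum_degree_in G A B : simple_graph G ->
  (\sum_(x in A) degree G x = nb_adj G A B + nb_adj G A (~: B))%N.
Proof.
move=> sG; rewrite /nb_adj -big_split; apply: eq_bigr => x _ /=.
rewrite degreeE // (bigID (mem B)) /=; congr (_ + _)%N.
by apply: eq_bigl => y; rewrite inE.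
Qed.

Lemma cut_swap G f e U : (cut_edges (swap f e G) U <= (cut_edges G U).+1)%N.
Proof.
pose C d := [exists u in U, exists v in ~: U, d == [set u; v]].
apply: (@leq_trans #|e |: [set d in G | C d]|).
  apply/subset_leq_card/fintype.subsetP => d.
  rewrite inE => /andP[]; rewrite in_setU1 => /orP[/eqP->|].
    by rewrite setU11.
  rewrite in_setD1 => /andP[_ dG] Cd; rewrite in_setU1 inE dG.
  by apply/orP; right; exact: Cd.
by rewrite cardsU1 -/(cut_edges G U) -add1n leq_add2r leq_b1.
Qed.

(** The first swap lowers the degree of [y] and raises that of [z]; the second one restores both. *)
Definition double_swap G (x y z w : 'I_n) :=
  swap [set z; w] [set y; w] (swap [set x; y] [set x; z] G).

Section Move.
Variables (G : {set {set 'I_n}}) (U : {set 'I_n}) (x y z w : 'I_n).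
Hypotheses (vG : valid_graph m G) (xU : x \in U) (yU : y \in U).
Hypotheses (zU : z \notin U) (wU : w \notin U).
Hypotheses (xy : adj G x y) (zw : adj G z w).
Hypotheses (xz : ~~ adj G x z) (yw : ~~ adj G y w).

Let neqU (u v : 'I_n) : u \in U -> v \notin U -> (u == v) = false.
Proof. by move=> uU vU; apply/eqP => uv; rewrite uv (negPf vU) in uU. Qed.

Let nxy : x != y.
Proof. by case/andP: vG => sG _; exact: adj_neq sG xy. Qed.

Let nzw : z != w.
Proof. by case/andP: vG => sG _; exact: adj_neq sG zw. Qed.

(** The second swap acts on the intermediate graph. There [zw] is still an edge, since [U] separates
    it from [xy], and [yw] still a non-edge, since it differs from [xz]. *)
Let zw' : adj (swap [set x; y] [set x; z] G) z w.
Proof.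
rewrite adj_swap zw andbT !eq_set2 (eq_sym z x) (eq_sym z y).
by rewrite (neqU xU zU) (neqU yU zU) /= orbT.
Qed.

Let yw' : ~~ adj (swap [set x; y] [set x; z] G) y w.
Proof.
rewrite adj_swap (negPf yw) andbF orbF eq_set2 (eq_sym y x) (negPf nxy).
by rewrite (neqU yU zU).
Qed.

Lemma double_swapK : swap [set x; z] [set x; y]
  (swap [set y; w] [set z; w] (double_swap G x y z w)) = G.
Proof. by rewrite /double_swap !swapK. Qed.

Lemma double_swap_valid : valid_graph m (double_swap G x y z w).
Proof.
rewrite /double_swap; apply: valid_swap => //; last first.
  by rewrite cards2 (neqU yU wU).
by apply: valid_swap => //; rewrite cards2 (neqU xU zU).
Qed.

Lemma double_swap_degree i : degree (double_swap G x y z w) i = degree G i.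
Proof.
have in2 (u v : 'I_n) : u != v ->
    (i \in [set u; v] : nat) = ((i == u) + (i == v))%N.
  by rewrite !inE; have [->|] := eqVneq i u => //= /negPf->.
have := swap_degree i zw' yw'; have := swap_degree i xy xz.
rewrite -/(double_swap G x y z w) !in2 ?(neqU xU zU) ?(neqU yU wU) //.
set d1 := degree (swap _ _ G) i; set d2 := degree (double_swap _ _ _ _ _) i.
move: d1 d2 (degree G i) (i == x) (i == y) (i == z) (i == w); clear; lia.
Qed.

Lemma double_swap_cut :
  (cut_edges (double_swap G x y z w) U <= cut_edges G U + 2)%N.
Proof.
have := cut_swap (swap [set x; y] [set x; z] G) [set z; w] [set y; w] U.
have := cut_swap G [set x; y] [set x; z] U; rewrite /double_swap.
by clear; lia.
Qed.

Lemma double_swap_adj1 : adj (double_swap G x y z w) x z.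
Proof.
rewrite !adj_swap eqxx orTb andbT !eq_set2 (neqU xU zU) (neqU xU wU).
by rewrite /= orbT.
Qed.

Lemma double_swap_adj2 : adj (double_swap G x y z w) y w.
Proof. by rewrite adj_swap eqxx. Qed.

End Move.

(** With [k = #|U|], an inverse move is a choice of two cut edges, at most
    [(b + 2)^2 <= (s k / 8)^2] in number, against at least [(s k) (s n) / 16] moves forward. The
    quotient is [k / (4 n)]. *)
Lemma cut_step U (b : nat) :
  (0 < #|U|)%N -> (2 * #|U| <= n)%N -> (8 * (b + 2) <= s * #|U|)%N ->
  mu_prob beta m (fun G => good_degrees s G && (cut_edges G U <= b)%N) <=
  #|U|%:R / (4 * n%:R) *
  mu_prob beta m (fun G => good_degrees s G && (cut_edges G U <= b + 2)%N).
Proof.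
set k := #|U| => k_gt0 kn le_b.
have n_gt0 : (0 < n)%N by lia.
pose A G (p : ('I_n * 'I_n) * ('I_n * 'I_n)) :=
  [&& p.1.1 \in U, p.1.2 \in U & adj G p.1.1 p.1.2] &&
  [&& p.2.1 \in ~: U, p.2.2 \in ~: U & adj G p.2.1 p.2.2] &&
  (~~ adj G p.1.1 p.2.1 && ~~ adj G p.1.2 p.2.2).
pose B G (p : ('I_n * 'I_n) * ('I_n * 'I_n)) :=
  [&& p.1.1 \in U, p.2.1 \in ~: U & adj G p.1.1 p.2.1] &&
  [&& p.1.2 \in U, p.2.2 \in ~: U & adj G p.1.2 p.2.2].
set P := fun G => _ && (_ <= b)%N; set Q := fun G => _ && (_ <= b + 2)%N.
have : ((s * k) * (s * n))%:R / 16 * mu_prob beta m P <=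
    ((b + 2) ^ 2)%N%:R * mu_prob beta m Q.
  apply: (@mu_switching _ _ _ _ _ _ _ A B
    (fun p G => double_swap G p.1.1 p.1.2 p.2.1 p.2.2)
    (fun p G => swap [set p.1.1; p.2.1] [set p.1.1; p.1.2]
      (swap [set p.1.2; p.2.2] [set p.2.1; p.2.2] G)) (fun _ _ => 1)) => G.
  - move=> [[x y] [z w]] vG /andP[goodG cutG].
    case/andP=> /andP[/and3P[/= xU yU xy]] /and3P[/= zU wU zw] /andP[xz yw].
    rewrite !inE in zU wU.
    split.
    + by rewrite /= (double_swapK vG xU yU zU).
    + rewrite /Q; apply/andP; split.
        apply/forallP => v; rewrite (double_swap_degree vG xU yU) //.
        exact: (forallP goodG).
      rewrite (leq_trans (double_swap_cut _ _ _ _ _ _)) // leq_add2r.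
      exact: cutG.
    + rewrite /B /= !inE xU yU zU wU double_swap_adj2.
      by rewrite (double_swap_adj1 _ _ xU zU wU).
    + rewrite mul1r (@mu_eq_degree _ _ _ _ G) //.
        by apply: (double_swap_valid vG xU yU zU wU).
      by move=> i; rewrite (double_swap_degree vG xU yU).
  - move=> vG /andP[/forallP goodG cutG]; have /andP[sG /eqP mG] := vG.
    rewrite sumr_const; set c := #|_|.
    have cE : c = (\sum_x \sum_y \sum_z \sum_w A G ((x, y), (z, w)))%N.
      rewrite pair_big /=.
      under eq_bigr => p _ do rewrite pair_big /=.
      rewrite pair_big /= /c -sum1_card big_mkcond /=.
      by apply: eq_bigr => -[[x y] [z w]] _; rewrite unfold_in /A /=; case: ifP.
    pose D := (131 * s)%N.
    have deg_le x : (degree G x <= D)%N by case/andP: (goodG x).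
    have path_le x : (\sum_z \sum_w (adj G x z && adj G z w) <= D * D)%N.
      apply: (@leq_trans (\sum_z adj G x z * D)%N).
        apply: leq_sum => z _; case: (adj G x z); last by rewrite big1.
        by rewrite mul1n /= -degreeE.
      by rewrite -big_distrl /= -degreeE // leq_mul2r deg_le orbT.
    set V2 := nb_adj G U U; set W := nb_adj G (~: U) (~: U).
    (* For given [x], [y], a pair [z], [w] is lost only if [x z w] or [y w z] is a path, and there
       are at most [D ^ 2] paths of each kind. *)
    have fwd : (V2 * W <= c + V2 * (2 * (D * D)))%N.
      rewrite /V2 nb_adjE big_distrl /= big_distrl /= cE -big_split /=.
      apply: leq_sum => x _; rewrite big_distrl /= big_distrl /= -big_split /=.
      apply: leq_sum => y _; rewrite /A /=.
      case: [&& x \in U, y \in U & adj G x y]; last by rewrite mul0n.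
      rewrite !mul1n /=.
      have := path_le x; have := path_le y; rewrite [X in (X <= _ -> _)%N]exchange_big /=.
      move=> py px.
      apply: (@leq_trans (\sum_z \sum_w ([&& z \in ~: U, w \in ~: U & adj G z w] &&
          (~~ adj G x z && ~~ adj G y w) : nat) +
          (\sum_z \sum_w (adj G x z && adj G z w) +
           \sum_z \sum_w (adj G y w && adj G w z)))%N); last first.
        by rewrite leq_add2l mul2n -addnn leq_add.
      rewrite /W nb_adjE -!big_split /=; apply: leq_sum => z _.
      rewrite -!big_split /=; apply: leq_sum => w _.
      rewrite (adjC G w z).
      case: (z \in _); case: (w \in _); case: (adj G z w) => //=.
      by case: (adj G x z); case: (adj G y w).
    (* The degrees in [U] sum to at least [s k] and the cut takes at most [b <= s k / 8] of this, so
       [V2 >= 7 s k / 8]. Likewise [W >= 7 s n / 16], and subtracting [2 D ^ 2 <= s n / 8] leaves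
       [5 s n / 16]. *)
    have lo (S : {set 'I_n}) : (#|S| * s <= \sum_(x in S) degree G x)%N.
      rewrite -sum_nat_const; apply: leq_sum => x _.
      by case/andP: (goodG x) => /ltnW.
    have V2_ge : (s * k <= V2 + b)%N.
      have := lo U; rewrite (sum_degree_in U U sG) -/V2 -/k.
      rewrite /nb_adj -cut_edgesE; move: cutG; clear; lia.
    have W_ge : (s * (n - k) <= W + b)%N.
      have := lo (~: U); rewrite (sum_degree_in (~: U) (~: U) sG) -/W.
      rewrite finset.setCK nb_adjC /nb_adj -cut_edgesE cardsCs finset.setCK card_ord -/k.
      move: cutG; clear; lia.
    have D_le : (16 * (D * D) <= s * n)%N.
      move: n_large; rewrite -(leq_pmul2l s_gt0) /D; clear; lia.
    have V2_ge' : (7 * (s * k) <= 8 * V2)%N by lia.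
    have W_ge' : (7 * (s * n) <= 16 * W)%N.
      have : (2 * (s * k) <= s * n)%N by rewrite mulnCA leq_mul2l kn orbT.
      have : (s * n <= 2 * (s * (n - k)))%N.
        by rewrite mulnCA leq_mul2l; apply/orP; right; lia.
      move: W_ge le_b; clear; lia.
    have : (s * k * (s * n) <= 16 * c)%N.
      have h1 : (5 * (s * n) <= 16 * (W - 2 * (D * D)))%N by lia.
      have h2 : (V2 * (W - 2 * (D * D)) <= c)%N by rewrite mulnBr; lia.
      have := leq_mul V2_ge' h1; move: h2; clear; nia.
    rewrite -(ler_nat R) natrM.
    have -> : (16 * c)%:R = 16 * c%:R :> R by rewrite natrM.
    by move=> h; rewrite -[_ *+ c]/(c%:R) natrM; lra.
  - move=> vG /andP[_ cutG]; have /andP[sG /eqP mG] := vG.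
    have cE : cut_edges G U = nb_adj G U (~: U) by rewrite cut_edgesE.
    apply: (@leq_trans (cut_edges G U * cut_edges G U)); last first.
      by rewrite expnS expn1 leq_mul.
    rewrite cE nb_adjE -(pair_bigA _ (fun p q => B G (p, q) : nat)) /=.
    rewrite -(pair_bigA _ (fun x y => \sum_q B G ((x, y), q) : nat)) /=.
    rewrite big_distrl /=; apply: leq_sum => x _.
    under eq_bigr => y _ do
      rewrite -(pair_bigA _ (fun z w => B G ((x, y), (z, w)) : nat)) /=.
    rewrite exchange_big /= big_distrl /=; apply: leq_sum => z _.
    rewrite big_distrr /=; apply: leq_sum => y _.
    rewrite big_distrr /=; apply: leq_sum => w _.
    by rewrite /B /=; case: [&& x \in U, _ & _]; rewrite ?mul1n.
set p := mu_prob _ _ _; set p' := mu_prob _ _ _ => step.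
have p'0 : 0 <= p' by exact: mu_prob_ge0.
have L0 : 0 < ((s * k) * (s * n))%:R / 16 :> R.
  by rewrite divr_gt0 // ltr0n !muln_gt0 s_gt0 k_gt0 n_gt0.
rewrite -(ler_pM2l L0) (le_trans step) // mulrA ler_wpM2r //.
have -> : ((s * k) * (s * n))%:R / 16 * (k%:R / (4 * n%:R)) =
    ((s * k) ^ 2)%N%:R / 64 :> R.
  by rewrite natrX !natrM; field; rewrite pnatr_eq0; lia.
rewrite ler_pdivlMr // -natrM ler_nat.
have : ((8 * (b + 2)) ^ 2 <= (s * k) ^ 2)%N by rewrite leq_sqr.
by rewrite expnMn mulnC.
Qed.

(** With [k = #|U|], there are [t k] steps of 2 that raise the cut bound from [2 t k] to [4 t k].
    The last one requires [8 * (4 t k) <= s k], whence [s = 32 t]. *)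
Lemma small_cut_prob U (t : nat) : s = (32 * t)%N ->
  (0 < #|U|)%N -> (2 * #|U| <= n)%N -> (m <= 'C(n, 2))%N ->
  mu_prob beta m
    (fun G => good_degrees s G && (cut_edges G U <= 2 * t * #|U|)%N) <=
  (#|U|%:R / (4 * n%:R)) ^+ (t * #|U|).
Proof.
move=> st k_gt0 kn mC; set k := #|U|; set q := _ / _.
have q0 : 0 <= q by rewrite divr_ge0 // mulr_ge0.
pose g i := mu_prob beta m
  (fun G => good_degrees s G && (cut_edges G U <= 2 * t * k + 2 * i)%N).
have := @geometric_chain R g q (t * k) q0 _; rewrite /g muln0 addn0 => H.
apply: (le_trans (H _)) => [i ilt|].
  have -> : (2 * t * k + 2 * i.+1 = 2 * t * k + 2 * i + 2)%N by lia.
  by apply: cut_step; rewrite // -/k st; lia.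
by rewrite -[leRHS]mulr1 ler_wpM2l ?exprn_ge0 ?mu_prob_le1.
Qed.

End DoubleSwitch.

(** * Union bound over vertex sets *)

Section UnionBound.
Variable R : realType.

(** Expands a product of [n] equal factors, [U] being the set of indices that contribute [x]; no
    binomial coefficient appears. *)
Lemma sum_expr_card n (x : R) : \sum_(U : {set 'I_n}) x ^+ #|U| = (1 + x) ^+ n.
Proof.
have := @bigA_distr R 0 1 *%R +%R 'I_n (fun=> x) (fun=> 1).
rewrite prodr_const card_ord addrC => ->; apply: eq_bigr => U _.
by rewrite -big_mkcond prodr_const.
Qed.

Lemma geometric_sum_le (z : R) n : 0 <= z -> 2 * z <= 1 ->
  \sum_(k < n) z ^+ k.+1 <= 2 * z.
Proof.
move=> z0 z1; suff : \sum_(k < n) z ^+ k.+1 <= 2 * z - 2 * z ^+ n.+1.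
  by have := exprn_ge0 n.+1 z0; lra.
elim: n => [|n IH]; first by rewrite big_ord0 expr1 subrr.
rewrite big_ord_recr /= (exprS z n.+1).
by have := ler_wpM2r (exprn_ge0 n.+1 z0) z1; move: IH; lra.
Qed.

(** Obtained by squaring [exp (- 1/2) >= 1 - 1/2]. *)
Lemma expR1_le4 : expR 1 <= 4 :> R.
Proof.
have h : 2^-1 <= expR (- 2^-1) :> R by have := expR_ge1Dx (- 2^-1 : R); lra.
have -> : (1 : R) = 2^-1 + 2^-1 by lra.
rewrite expRD -(ler_pM2r (expR_gt0 (- 2^-1))) -mulrA -expRD addrN expR0 mulr1.
rewrite -(ler_pM2r (expR_gt0 (- 2^-1))) -expRD addrN expR0 -mulrA -expr2.
by have : 2^-1 ^+ 2 <= expR (- 2^-1) ^+ 2 :> R; [rewrite lerXn2r ?nnegrE ?expR_ge0|lra].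
Qed.

(** For sets of size [k], one factor [(k / (4 n)) ^ k] outweighs their number, and the other [t] are
    at most [8^-1 ^ (t k)] because [2 k <= n]. A geometric series in [k] remains. *)
Lemma sum_small_sets n t : (0 < t)%N ->
  \sum_(U : {set 'I_n} | ((0 < #|U|) && (2 * #|U| <= n))%N)
    (#|U|%:R / (4 * n%:R)) ^+ (t.+1 * #|U|) <= 2 * 8^-1 ^+ t :> R.
Proof.
move=> t0; pose z : R := 8^-1 ^+ t.
have z0 : 0 <= z by rewrite exprn_ge0.
have z1 : 2 * z <= 1.
  have : z <= 8^-1 by rewrite /z -[leRHS]expr1 ler_wiXn2l //; lra.
  by lra.
rewrite (partition_big (fun U : {set 'I_n} => inord #|U| : 'I_n.+1) predT) //=.
(* This makes [inord #|U|] faithful, so the classes are the sets of a given size. *)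
have card_lt (U : {set 'I_n}) : (#|U| < n.+1)%N.
  by rewrite ltnS -[leqRHS]card_ord max_card.
rewrite big_ord_recl big1 ?add0r; last first.
  move=> U /andP[/andP[U0 _] /eqP/(congr1 val)/=]; rewrite inordK // => U00.
  by rewrite U00 in U0.
apply: le_trans (geometric_sum_le n z0 z1); apply: ler_sum => k _.
set K := k.+1; have [nK|Kn] := ltnP n (2 * K).
  rewrite big1 ?exprn_ge0 // => U /andP[/andP[_ Un] /eqP/(congr1 val)/=].
  rewrite inordK // /bump /= add1n -/K => UK.
  by move: nK; rewrite ltnNge -UK Un.
have n0 : 0 < n%:R :> R by rewrite ltr0n; lia.
set x : R := K%:R / n%:R.
have x0 : 0 <= x by rewrite divr_ge0.
have x8 : x / 4 <= 8^-1.
  rewrite /x ler_pdivrMr // ler_pdivrMr //.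
  by move: Kn; rewrite -(ler_nat R) natrM; lra.
(* Summing over sets of all sizes yields [(1 + x) ^ n <= exp K <= 4 ^ K], which cancels
   [4^-1 ^ K]. *)
apply: (@le_trans _ _ (\sum_(U : {set 'I_n}) x ^+ #|U| * (4^-1 ^+ K * z ^+ K))).
  rewrite big_mkcond; apply: ler_sum => U _.
  case: ifP => [/andP[_ /eqP/(congr1 val)/=]|_]; last first.
    by rewrite !mulr_ge0 ?exprn_ge0.
  rewrite inordK // /bump /= add1n -/K => ->.
  have -> : K%:R / (4 * n%:R) = x / 4.
    by rewrite /x; field; rewrite gt_eqF.
  rewrite mulSn exprD exprMn -mulrA ler_wpM2l ?exprn_ge0 //.
  rewrite ler_wpM2l ?exprn_ge0 // /z -exprM lerXn2r ?nnegrE ?divr_ge0 //.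
rewrite -mulr_suml sum_expr_card mulrA -[leRHS]mul1r ler_wpM2r ?exprn_ge0 //.
apply: (@le_trans _ _ (expR 1 ^+ K * 4^-1 ^+ K)).
  rewrite ler_wpM2r ?exprn_ge0 // -expRM_natr mul1r.
  have -> : K%:R = x *+ n by rewrite -[RHS]mulr_natr /x divfK // gt_eqF.
  rewrite -[x *+ n]mulr_natr expRM_natr lerXn2r ?nnegrE ?expR_ge0 //.
    by rewrite addr_ge0.
  exact: expR_ge1Dx.
rewrite -exprMn exprn_ile1 ?mulr_ge0 ?expR_ge0 //.
by rewrite ler_pdivrMr // mul1r expR1_le4.
Qed.

Definition expander n t (G : {set {set 'I_n}}) :=
  [forall U : {set 'I_n}, (2 * #|U| <= n)%N ==>
     (2 * t * #|U| <= cut_edges G U)%N].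

Lemma expander_prob (beta : R) n m t : 0 < beta -> (1 < t)%N ->
  (524 * 524 * (32 * t) <= n)%N -> (m <= 'C(n, 2))%N ->
  (4 * n * (32 * t) <= m <= 8 * n * (32 * t))%N ->
  1 - (2 * n%:R * (2 * expR (- (4 * beta * (32 * t)%:R))) ^+ (3 * (32 * t)) +
       2 * 8^-1 ^+ t.-1) <= mu_prob beta m (@expander n t).
Proof.
move=> b0 t1 nt mC mt; set s := (32 * t)%N.
have s0 : (0 < s)%N by rewrite /s; lia.
pose D (U : {set 'I_n}) := ((0 < #|U|) && (2 * #|U| <= n))%N.
pose A (U : {set 'I_n}) (G : {set {set 'I_n}}) :=
  good_degrees s G && (cut_edges G U <= 2 * t * #|U|)%N.
have : 1 <= mu_prob beta m (@expander n t) +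
    mu_prob beta m (fun G => ~~ good_degrees s G || [exists (U | D U), A U G]).
  rewrite -(mu_total beta mC); apply: le_trans (mu_probU _ _ _ _).
  apply: (@mu_prob_sub _ _ _ _ predT) => G _ _.
  have [gG|] /= := boolP (good_degrees s G); last by rewrite orbT.
  have [//|/forallPn[U]] := boolP (expander t G).
  rewrite negb_imply -ltnNge => /andP[Un cutU] /=.
  apply/existsP; exists U; rewrite /D Un andbT /A gG /= (ltnW cutU) andbT.
  by case: posnP cutU => // ->; rewrite muln0.
have nlarge : (4 <= n)%N by lia.
have := good_degrees_prob b0 s0 nlarge mt mC.
(* Of the exponent [t] of [small_cut_prob], one unit pays for the number of sets, which leaves
   [t.-1]. *)
have : \sum_(U | D U) mu_prob beta m (A U) <= 2 * 8^-1 ^+ t.-1.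
  have t1' : (0 < t.-1)%N by lia.
  apply: le_trans (sum_small_sets n t1'); apply: ler_sum => U /andP[U0 Un].
  by rewrite prednK ?(ltnW t1) //; exact: small_cut_prob.
have := mu_probU beta m (fun G => ~~ good_degrees s G)
  (fun G => [exists (U | D U), A U G]).
have := mu_prob_exists beta m D A; lra.
Qed.

End UnionBound.

(** * Percolation on a graph with large cuts *)

Section Percolation.
Variables (R : realType) (n : nat).
Implicit Types (G H S : {set {set 'I_n}}) (U : {set 'I_n}).

Lemma survival_ge0 (p : R) G H : 0 <= p <= 1 -> 0 <= survival p G H.
Proof.
move=> /andP[p0 p1]; rewrite /survival; case: ifP => // _.
by apply: prodr_ge0 => e _; case: ifP => // _; rewrite subr_ge0.
Qed.

(** The sum expands a product of factors [F e + K e], for keeping or not keeping [e]. Such a factor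
    is [p] on [S] and 1 elsewhere. *)
Lemma survival_avoid (p : R) G S : S \subset G ->
  \sum_(H : {set {set 'I_n}} | [disjoint H & S]) survival p G H = p ^+ #|S|.
Proof.
move=> /fintype.subsetP SG.
pose F e := if e \in G :\: S then 1 - p else 0.
pose K e := if e \in G then p else 1.
have -> : p ^+ #|S| = \prod_(e : {set 'I_n}) (F e + K e).
  rewrite -prodr_const big_mkcond; apply: eq_bigr => e _; rewrite /F /K inE.
  have [/SG->|_] /= := boolP (e \in S); first by rewrite add0r.
  by case: (e \in G); rewrite ?subrK ?add0r.
rewrite (@bigA_distr R 0 1 *%R +%R) big_mkcond; apply: eq_bigr => H _.
have [HGS|/fintype.subsetPn[e eH eGS]] := boolP (H \subset G :\: S); last first.
  rewrite [RHS](bigD1 e) //= eH /F (negPf eGS) mul0r.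
  case: ifP => // /pred0P dHS; rewrite /survival ifN //.
  apply: contra eGS => /fintype.subsetP/(_ _ eH) eG.
  by have /= := dHS e; rewrite eH inE eG /= => ->.
have [HG dHS] : H \subset G /\ [disjoint H & S] by apply/andP; rewrite -subsetD.
rewrite dHS /survival HG big_mkcond; apply: eq_bigr => e _; rewrite /F /K.
have [eH|eH] := boolP (e \in H); last by [].
by rewrite (fintype.subsetP HG) // (fintype.subsetP HGS).
Qed.

Lemma survival_total (p : R) G :
  \sum_(H : {set {set 'I_n}}) survival p G H = 1.
Proof.
rewrite -(expr0 p) -(cards0 {set 'I_n}) -(@survival_avoid p G) ?finset.sub0set //.
by apply: eq_bigl => H; apply/esym/pred0P => e; rewrite /= inE andbF.
Qed.

(** Take the component of some vertex, or its complement if the component has more than half of the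
    vertices. *)
Lemma disconnected_cut H : ~~ connected_graph H ->
  exists2 U : {set 'I_n}, ((0 < #|U|) && (2 * #|U| <= n))%N &
    forall u v, u \in U -> v \notin U -> ~~ adj H u v.
Proof.
set e := fun u v => adj H u v; have se : symmetric e by move=> u v; exact: adjC.
move=> /forallPn[x /forallPn[y nxy]].
pose C : {set 'I_n} := [set z | connect e x z].
have C_cut u v : u \in C -> v \notin C -> ~~ adj H u v.
  rewrite !inE => xu; apply: contra => uv.
  exact: connect_trans xu (connect1 uv).
have [Cn|Cn] := leqP (2 * #|C|) n.
  exists C => //; rewrite Cn andbT; apply/card_gt0P; exists x.
  by rewrite inE connect0.
exists (~: C).
  apply/andP; split; first by apply/card_gt0P; exists y; rewrite !inE.
  by move: Cn; rewrite [#|~: C|]cardsCs finset.setCK card_ord; clear; lia.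
move=> u v; rewrite !inE negbK => uC vC; rewrite adjC.
by apply: C_cut; rewrite inE.
Qed.

Lemma connected_survival (p x : R) G : 0 <= p <= 1 -> 0 <= x ->
  (forall U, ((0 < #|U|) && (2 * #|U| <= n))%N ->
     p ^+ cut_edges G U <= x ^+ #|U|) ->
  1 - ((1 + x) ^+ n - 1) <= \sum_(H | @connected_graph n H) survival p G H.
Proof.
move=> p01 x0 cut_small.
pose S U := [set e in G | [exists u in U, exists v in ~: U, e == [set u; v]]].
pose D U := ((0 < #|U|) && (2 * #|U| <= n))%N.
suff : \sum_(H | ~~ @connected_graph n H) survival p G H <= (1 + x) ^+ n - 1.
  by have := survival_total p G; rewrite (bigID (@connected_graph n)) /=; lra.
apply: (@le_trans _ _ (\sum_(U | D U)
    \sum_(H : {set {set 'I_n}} | [disjoint H & S U]) survival p G H)).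
  rewrite (exchange_big_dep predT) //= big_mkcond; apply: ler_sum => H _.
  case: ifP => [/disconnected_cut[U DU cutU]|_]; last first.
    by apply: sumr_ge0 => U _; exact: survival_ge0.
  rewrite (bigD1 U) /=; first by rewrite lerDl sumr_ge0 // => V _; exact: survival_ge0.
  apply/andP; split; first exact: DU.
  apply/pred0P => e /=; apply/negP => /andP[eH].
  rewrite inE => /andP[_ /exists_inP[u uU /exists_inP[v vU /eqP eE]]].
  rewrite inE in vU.
  by have := cutU u v uU vU; rewrite /adj -eE eH.
apply: (@le_trans _ _ (\sum_(U | D U) x ^+ #|U|)).
  apply: ler_sum => U DU; rewrite survival_avoid; first exact: cut_small.
  by apply/fintype.subsetP => e; rewrite inE => /andP[].
(* The empty set accounts for the subtracted 1. *)
rewrite -sum_expr_card [X in _ <= X - _](bigD1 finset.set0) //= cards0 expr0.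
rewrite [1 + _]addrC addrK.
rewrite big_mkcond [leRHS]big_mkcond; apply: ler_sum => U _.
rewrite /D -card_gt0; case: (0 < #|U|)%N => //=; case: ifP => // _.
by rewrite exprn_ge0.
Qed.

Variables (beta : R) (m : nat).

Lemma percolation_prob_le1 (p : R) A : (m <= 'C(n, 2))%N -> 0 <= p <= 1 ->
  percolation_prob beta m p (A : pred {set {set 'I_n}}) <= 1.
Proof.
move=> mC p01; rewrite -(mu_total beta mC); apply: ler_sum => G _.
rewrite -[leRHS]mulr1 ler_wpM2l ?mu_ge0 // -(survival_total p G).
rewrite [leRHS](bigID A) /= lerDl sumr_ge0 // => H _; exact: survival_ge0.
Qed.

Lemma connected_percolation (p x : R) (A : pred {set {set 'I_n}}) :
  0 <= p <= 1 -> 0 <= x ->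
  (forall G U, A G -> ((0 < #|U|) && (2 * #|U| <= n))%N ->
     p ^+ cut_edges G U <= x ^+ #|U|) ->
  mu_prob beta m A * (2 - (1 + x) ^+ n) <=
    percolation_prob beta m p (@connected_graph n).
Proof.
move=> p01 x0 small; rewrite /mu_prob mulr_suml big_mkcond.
apply: ler_sum => G _; case: ifP => [AG|_]; last first.
  rewrite mulr_ge0 ?mu_ge0 ?sumr_ge0 // => H _; exact: survival_ge0.
rewrite ler_wpM2l ?mu_ge0 //.
have := connected_survival p01 x0 (fun U => small G U AG); lra.
Qed.

End Percolation.

(** * Asymptotics *)

Local Open Scope classical_set_scope.
Local Open Scope ring_scope.

Section Asymptotics.
Variables (R : realType) (c : R).
Hypothesis c_gt0 : 0 < c.

Lemma near_ln_ge (A : R) : \forall n \near \oo, A <= ln n%:R.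
Proof.
near=> n; rewrite -[A]expRK ler_ln ?posrE ?expR_gt0 //.
  by near: n; exact: nbhs_infty_ger.
by rewrite ltr0n; near: n; exact: nbhs_infty_gt.
Unshelve. all: by end_near. Qed.

(** Split [ln n] as [ln (n eta / 2) + ln (2 / eta)]: the first term is at most [n eta / 2] and the
    second is constant. *)
Lemma near_ln_le (eta : R) : 0 < eta -> \forall n \near \oo, ln n%:R <= eta * n%:R.
Proof.
move=> eta0; near=> n.
have n0 : 0 < n%:R :> R by rewrite ltr0n; near: n; exact: nbhs_infty_gt.
have K0 : 0 < 2 / eta by rewrite divr_gt0.
have -> : n%:R = (n%:R * (eta / 2)) * (2 / eta) :> R.
  by field; rewrite gt_eqF.
have m0 : 0 < n%:R * (eta / 2) by rewrite mulr_gt0 ?divr_gt0.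
rewrite lnM ?posrE //.
have -> : eta * (n%:R * (eta / 2) * (2 / eta)) = n%:R * (eta / 2) + n%:R * (eta / 2).
  by field; rewrite gt_eqF.
rewrite lerD //; first exact/ltW/ln_sublinear.
rewrite -ler_pdivrMr ?divr_gt0 //.
by near: n; exact: nbhs_infty_ger.
Unshelve. all: by end_near. Qed.

(* With T := density_scale n, the mean degree c ln n is between 256 T and
   512 T, so that cuts of size 2 T |U| contain a fraction 1/256 of it. *)
Definition density_scale (n : nat) : nat := (nb_edges c n %/ (128 * n))%N.

Let x_ge0 n : (0 < n)%N -> 0 <= 2^-1 * c * n%:R * ln n%:R.
Proof.
by move=> n0; rewrite !mulr_ge0 ?ln_ge0 ?ler1n // ltW.
Qed.

(** The nested floors cost no more than one: between integers, [E < 128 n (T + 1)] gives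
    [E + 1 <= 128 n (T + 1)]. *)
Lemma density_scale_bounds n : (0 < n)%N ->
  256 * (density_scale n)%:R <= c * ln n%:R < 256 * ((density_scale n)%:R + 1).
Proof.
move=> n0; have nR : 0 < n%:R :> R by rewrite ltr0n.
have /andP[lo hi] := truncn_itv (x_ge0 n0); rewrite -/(nb_edges c n) in lo hi.
have d0 : (0 < 128 * n)%N by rewrite muln_gt0.
have := leq_trunc_div (nb_edges c n) (128 * n).
have := ltn_ceil (nb_edges c n) d0; rewrite -/(density_scale n).
set T := density_scale n; rewrite -(ler_nat R) -[in X in _ -> X](ler_nat R).
rewrite !natrM -(natr1 T) -(natr1 (nb_edges c n)) => hi' lo'.
rewrite -(ler_pM2l nR) -(ltr_pM2l nR).
by apply/andP; split; lra.
Qed.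

Lemma ln_le_density_scale n : (0 < n)%N -> 1 <= (density_scale n)%:R :> R ->
  c * ln n%:R <= 512 * (density_scale n)%:R.
Proof. by move=> /density_scale_bounds/andP[_]; lra. Qed.

Lemma density_scale_edges n : (0 < n)%N -> (0 < density_scale n)%N ->
  (4 * n * (32 * density_scale n) <= nb_edges c n <=
   8 * n * (32 * density_scale n))%N.
Proof.
move=> n0 T0; have := leq_trunc_div (nb_edges c n) (128 * n).
have d0 : (0 < 128 * n)%N by rewrite muln_gt0.
have := ltn_ceil (nb_edges c n) d0; rewrite -/(density_scale n).
by move: T0; clear; nia.
Qed.

Lemma near_density_scale (r : R) : \forall n \near \oo, r <= (density_scale n)%:R.
Proof.
near=> n; have n0 : (0 < n)%N by near: n; exact: nbhs_infty_gt.
have /andP[_] := density_scale_bounds n0.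
have : 256 * (r + 1) / c <= ln n%:R by near: n; exact: near_ln_ge.
by rewrite ler_pdivrMr // mulrC; lra.
Unshelve. all: by end_near. Qed.

Lemma density_scale_cvg : density_scale n @[n --> \oo] --> \oo.
Proof.
apply/cvgnyPge => A; near=> n; rewrite -(ler_nat R); near: n.
exact: near_density_scale.
Unshelve. all: by end_near. Qed.

Lemma half_power_cvg : (2^-1 : R) ^+ density_scale n @[n --> \oo] --> (0 : R).
Proof.
apply: cvg_comp density_scale_cvg _; apply: cvg_expr.
by rewrite ger0_norm ?invr_ge0 // invf_lt1 // ltr1n.
Qed.

(** Eventually [c ln n <= n / 2 <= n - 1], and [E <= c n ln n / 2]. *)
Lemma near_edges_le : \forall n \near \oo, (nb_edges c n <= 'C(n, 2))%N.
Proof.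
have d_gt0 : 0 < (2 * c)^-1 by rewrite invr_gt0 mulr_gt0.
near=> n; have n2 : (2 <= n)%N by near: n; exact: nbhs_infty_ge.
have n0 : (0 < n)%N := leq_trans (isT : 0 < 2)%N n2.
have /andP[lo _] := truncn_itv (x_ge0 n0); rewrite -/(nb_edges c n) in lo.
have ln_le : ln n%:R <= (2 * c)^-1 * n%:R.
  by near: n; exact: near_ln_le.
rewrite bin2 -divn2 leq_divRL // -(ler_nat R) !natrM -subn1 natrB //.
have nR : 2 <= n%:R :> R by rewrite ler_nat.
have : c * ln n%:R <= n%:R / 2.
  apply: (le_trans (ler_wpM2l (ltW c_gt0) ln_le)).
  have -> // : c * ((2 * c)^-1 * n%:R) = n%:R / 2.
  by field; rewrite gt_eqF.
have nR0 : 0 <= n%:R :> R by exact: ler0n.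
move=> /(ler_wpM2l nR0); nra.
Unshelve. all: by end_near. Qed.

Variable beta : R.
Hypothesis beta_gt0 : 0 < beta.

(** Since [y = 1 / (2 A)] and [n <= A ^ T], already [T] of the [96 T] factors bring [n] down to
    [2^-1 ^ T]. The second summand is at most [4 * 2^-1 ^ T]. *)
Lemma tail_le (n T : nat) (A y q : R) : (0 < T)%N -> 0 <= q <= y -> y <= 1 ->
  A * y = 2^-1 -> 0 <= A -> n%:R <= A ^+ T ->
  2 * n%:R * q ^+ (3 * (32 * T)) + 2 * 8^-1 ^+ T.-1 <= 6 * 2^-1 ^+ T.
Proof.
move=> T0 /andP[q0 qy] y1 Ay A0 nA.
have y0 : 0 <= y by exact: le_trans qy.
have qT : q ^+ (3 * (32 * T)) <= y ^+ T.
  apply: (@le_trans _ _ (y ^+ (3 * (32 * T)))).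
    by rewrite lerXn2r ?nnegrE.
  by rewrite ler_wiXn2l //; lia.
have e8 : 8^-1 ^+ T.-1 <= 2 * 2^-1 ^+ T :> R.
  rewrite -[X in _ <= 2 * _ ^+ X](prednK T0) exprS mulrA divff ?pnatr_eq0 //.
  by rewrite mul1r lerXn2r ?nnegrE ?invr_ge0 // lef_pV2 ?posrE // ler_nat.
have nq : n%:R * q ^+ (3 * (32 * T)) <= 2^-1 ^+ T.
  apply: (@le_trans _ _ (A ^+ T * y ^+ T)); first by rewrite ler_pM ?exprn_ge0.
  by rewrite -exprMn Ay.
by rewrite -mulrA; lra.
Qed.

Lemma near_tail_le : \forall n \near \oo,
  2 * n%:R * (2 * expR (- (4 * beta * (32 * density_scale n)%:R))) ^+
    (3 * (32 * density_scale n)) + 2 * 8^-1 ^+ (density_scale n).-1 <=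
  6 * 2^-1 ^+ density_scale n.
Proof.
(* As [c ln n <= 512 T], this [a] gives [n <= exp (a) ^ T]. *)
have [a a0 ca] : exists2 a : R, 0 <= a & c * a = 512.
  exists (512 / c); first exact: divr_ge0 (ler0n _ _) (ltW c_gt0).
  by rewrite mulrC divfK // gt_eqF.
(* The threshold for [q <= y]: it suffices that [- (128 beta T) <= b], which holds for large [T]. *)
have [b bE] : exists b : R, 2 * expR b = 2^-1 * expR (- a).
  exists (ln (2^-1 * expR (- a) / 2)).
  rewrite lnK ?posrE ?divr_gt0 ?mulr_gt0 ?expR_gt0 //.
  by rewrite mulrC divfK.
near=> n.
have n0 : (0 < n)%N by near: n; exact: nbhs_infty_gt.
have T1 : 1 <= (density_scale n)%:R :> R by near: n; exact: near_density_scale.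
have Tb : - b / (128 * beta) <= (density_scale n)%:R.
  by near: n; exact: near_density_scale.
apply: (@tail_le _ _ (expR a) (2^-1 * expR (- a))).
- by rewrite -(ltr_nat R) (lt_le_trans _ T1).
- rewrite mulr_ge0 ?expR_ge0 //= -bE ler_wpM2l // ler_expR natrM.
  by move: Tb; rewrite ler_pdivrMr ?mulr_gt0 // lerNl; lra.
- have : expR (- a) <= 1 by rewrite expR_le1 oppr_le0.
  by have := expR_ge0 (- a); lra.
- by rewrite mulrCA -expRD addrN expR0 mulr1.
- exact: expR_ge0.
- rewrite -expRM_natr -[leLHS]lnK ?posrE ?ltr0n // ler_expR.
  rewrite -(ler_pM2l c_gt0) mulrA ca.
  exact: ln_le_density_scale.
Unshelve. all: by end_near. Qed.

Lemma expander_cvg :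
  mu_prob beta (nb_edges c n) (@expander n (density_scale n))
    @[n --> \oo] --> (1 : R).
Proof.
apply: (@squeeze_cvgr _ _ _ _ (fun n => 1 - 6 * 2^-1 ^+ density_scale n) (fun=> 1)).
(* Since [524 * 524 * 32 = 256 * 262 * 131], the bounds [256 T <= c ln n <= n / (262 * 131)] give
   the size condition of [expander_prob]. *)
- have d_gt0 : 0 < c^-1 / 262 / 131.
    by rewrite !(divr_gt0, invr_gt0, ltr0n).
  near=> n; set T := density_scale n.
  have mC : (nb_edges c n <= 'C(n, 2))%N by near: n; exact: near_edges_le.
  have n0 : (0 < n)%N by near: n; exact: nbhs_infty_gt.
  have T2 : (2 <= T)%N.
    by rewrite -(ler_nat R) /T; near: n; exact: near_density_scale.
  rewrite mu_prob_le1 // andbT.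
  have nT : (524 * 524 * (32 * T) <= n)%N.
    have /andP[lo _] := density_scale_bounds n0.
    have : ln n%:R <= c^-1 / 262 / 131 * n%:R.
      by near: n; exact: near_ln_le.
    move=> /(ler_wpM2l (ltW c_gt0)).
    rewrite !mulrA divff ?gt_eqF // mul1r.
    rewrite -/T in lo; move=> hi; rewrite -(ler_nat R) !natrM; lra.
  have mT : (4 * n * (32 * T) <= nb_edges c n <= 8 * n * (32 * T))%N.
    exact: density_scale_edges n0 (ltnW T2).
  apply: le_trans (expander_prob beta_gt0 T2 nT mC mT).
  by rewrite lerB // /T; near: n; exact: near_tail_le.
- rewrite -[X in _ --> X]subr0 -[X in _ - X](mulr0 6).
  by apply: cvgB; [exact: cvg_cst|apply: cvgMr; exact: half_power_cvg].
- exact: cvg_cst.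
Unshelve. all: by end_near. Qed.

Lemma expander_cut n (G : {set {set 'I_n}}) (U : {set 'I_n}) : (0 < n)%N ->
  1 <= (density_scale n)%:R :> R -> expander (density_scale n) G ->
  (2 * #|U| <= n)%N ->
  c / 256 * #|U|%:R * ln n%:R <= (cut_edges G U)%:R.
Proof.
move=> n0 T1 /forallP/(_ U)/implyP H /H; rewrite -(ler_nat R) !natrM.
apply: le_trans; have hi := ln_le_density_scale n0 T1.
rewrite mulrAC ler_wpM2r //; lra.
Qed.

Lemma connected_cvg (p : R) : 0 <= p < expR (- (c / 256)^-1) ->
  percolation_prob beta (nb_edges c n) p (@connected_graph n)
    @[n --> \oo] --> (1 : R).
Proof.
have [eps epsE] : exists eps, eps = c / 256 by exists (c / 256).
have eps0 : 0 < eps by rewrite epsE divr_gt0 ?ltr0n.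
rewrite -epsE => /andP[p0 plt].
have p1 : p <= 1.
  by rewrite (le_trans (ltW plt)) // expR_le1 oppr_le0 invr_ge0 ltW.
(* The strict bound on [p] leaves room for a positive [eta], making [p ^ cut] at most
   [n ^ - (1 + eta)] per vertex of [U]. The case [p = 0] is separate as [ln p] has no meaning
   there. *)
have [eta eta0 peta] : exists2 eta : R, 0 < eta & p <= expR (- ((1 + eta) / eps)).
  move: p0; rewrite le_eqVlt => /orP[/eqP<-|p0].
    by exists 1; rewrite ?expR_ge0.
  exists (- (eps * ln p) - 1).
    have : ln p < - eps^-1 by rewrite -ltr_expR lnK ?posrE.
    by rewrite -(ltr_pM2l eps0) mulrN divff ?gt_eqF //; lra.
  have -> : - ((1 + (- (eps * ln p) - 1)) / eps) = ln p.
    by field; rewrite gt_eqF.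
  by rewrite lnK ?posrE.
(* [x n] is [n ^ - (1 + eta)], and [E n], the exponential of [n ^ - eta = n * x n], bounds
   [(1 + x n) ^ n]. *)
pose x (n : nat) := expR (- ((1 + eta) * ln n%:R)).
pose E (n : nat) := expR (expR (- (eta * ln n%:R))).
apply: (@squeeze_cvgr _ _ _ _ (fun n =>
  mu_prob beta (nb_edges c n) (@expander n (density_scale n)) * (2 - E n))
  (fun=> 1)).
- near=> n.
  have mC : (nb_edges c n <= 'C(n, 2))%N by near: n; exact: near_edges_le.
  have n0 : (0 < n)%N by near: n; exact: nbhs_infty_gt.
  have T1 : 1 <= (density_scale n)%:R :> R by near: n; exact: near_density_scale.
  rewrite percolation_prob_le1 ?p0 // andbT.
  have x0 : 0 <= x n by exact: expR_ge0.
  have low : mu_prob beta (nb_edges c n) (@expander n (density_scale n)) *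
      (2 - (1 + x n) ^+ n) <=
      percolation_prob beta (nb_edges c n) p (@connected_graph n).
    apply: connected_percolation => [|//|G U GX /andP[_ Un]]; first by rewrite p0.
    apply: (@le_trans _ _ (expR (- ((1 + eta) / eps)) ^+ cut_edges G U)).
      by rewrite lerXn2r ?nnegrE ?expR_ge0.
    rewrite /x -!expRM_natr ler_expR !mulNr lerN2.
    have -> : (1 + eta) * ln n%:R * #|U|%:R =
        (1 + eta) / eps * (eps * #|U|%:R * ln n%:R).
      by field; rewrite gt_eqF.
    rewrite ler_wpM2l ?divr_ge0 ?addr_ge0 ?(ltW eta0) ?(ltW eps0) //.
    by rewrite epsE; exact: expander_cut n0 T1 GX Un.
  apply: le_trans low; rewrite ler_wpM2l ?mu_prob_ge0 // lerB //.
  apply: (@le_trans _ _ (expR (x n) ^+ n)).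
    by rewrite lerXn2r ?nnegrE ?addr_ge0 ?expR_ge0 ?expR_ge1Dx.
  rewrite -expRM_natr /E ler_expR /x -{2}[n%:R]lnK ?posrE ?ltr0n //.
  by rewrite -expRD ler_expR; lra.
- have ln_oo : eta * ln (n%:R : R) @[n --> \oo] --> +oo.
    apply/cvgryPge => A; near=> n.
    rewrite mulrC -ler_pdivrMr //; near: n; exact: near_ln_ge.
  have E1 : E n @[n --> \oo] --> (1 : R).
    rewrite -[X in _ --> X]expR0.
    apply: (@cvg_comp _ _ _ (fun n => expR (- (eta * ln n%:R))) expR);
      last exact: continuous_expR.
    exact: (@cvg_comp _ _ _ (fun n => eta * ln n%:R) (fun x => expR (- x))
      _ _ _ ln_oo (@cvgr_expR R)).
  rewrite -[X in _ --> X]mulr1; apply: cvgM; first exact: expander_cvg.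
  have two_sub1 : 2 - 1 = 1 :> R by lra.
  by rewrite -[X in _ --> X]two_sub1; apply: cvgB E1; exact: cvg_cst.
- exact: cvg_cst.
Unshelve. all: by end_near. Qed.

End Asymptotics.

Theorem theorem6 (R : realType) (beta c : R) (beta_gt0 : 0 < beta) (c_gt0 : 0 < c) :
  exists delta : R,
    [/\ 0 < delta < 1,
        mu_prob beta (nb_edges c n)
          (fun G : {set {set 'I_n}} =>
             [forall U : {set 'I_n},
                (#|U|%:R <= n%:R / 2 :> R) ==>
                ((1 - delta) * c * #|U|%:R * ln n%:R <= (cut_edges G U)%:R)])
          @[n --> \oo] --> (1 : R)
      & forall p : R, 0 <= p < expR (- (c * (1 - delta))^-1) ->
          percolation_prob beta (nb_edges c n) p (@connected_graph n)
            @[n --> \oo] --> (1 : R)].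
Proof.
(* [1 - delta] is the fraction 1/256 of [expander_cut], whatever [beta] and [c] are. *)
exists (255 / 256).
have deltaE : 1 - 255 / 256 = 256^-1 :> R by lra.
split; first by lra.
- apply: (@squeeze_cvgr _ _ _ _ (fun n =>
    mu_prob beta (nb_edges c n) (@expander n (density_scale c n))) (fun=> 1)).
  + near=> n.
    have mC : (nb_edges c n <= 'C(n, 2))%N by near: n; exact: near_edges_le.
    have n0 : (0 < n)%N by near: n; exact: nbhs_infty_gt.
    have T1 : 1 <= (density_scale c n)%:R :> R.
      by near: n; exact: near_density_scale.
    rewrite mu_prob_le1 // andbT; apply: mu_prob_sub => G _ GX.
    apply/forallP => U; apply/implyP; rewrite ler_pdivlMr // mulrC -natrM ler_nat.
    by rewrite deltaE (mulrC _ c) => Un; exact: (expander_cut c_gt0 n0 T1 GX Un).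
  + exact: expander_cvg.
  + exact: cvg_cst.
- by move=> p; rewrite deltaE; exact: connected_cvg.
Unshelve. all: by end_near. Qed.
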